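(* Let $\tau$ be a finite nonempty set of proposition symbols, $t=2^{|\tau|}$, let $n\in\mathbb Z_+$ and let $d\in\mathbb N$. Put \[c_1:=\frac1t\sqrt{2t\ln(2t)},\qquad c_2:=\sqrt{\frac{\pi}{2t^3(4t)^{1/(t-1)}}}.\] Then $c_2<c_1$, and: (1) if $d\le n/t-c_1\sqrt n$, then the distribution $\equiv_d$ for models of size $n$ has a majority class; (2) if $d\ge n/t-c_2\sqrt n$, then the distribution $\equiv_d$ for models of size $n$ does not have a majority class.
   Context: Models: a $\tau$-model with domain $W$ assigns to each $p\in\tau$ a subset of $W$ (the points where $p$ is true). $\mathcal M$ is the set of all $2^{n|\tau|}$ $\tau$-models with domain $\{1,\dots,n\}$. Logic: propositional formulas are $\psi ::= p\mid\neg p\mid\psi\wedge\psi\mid\psi\vee\psi$ with $p\in\tau$. Formulas of $\mathrm{GMLU}$ are built from $\diamond^{\ge k}\psi$, $\blacksquare^{<k}\psi$, $\diamond^{=k}\psi$, $\blacksquare^{\ne k}\psi$ ($\psi$ propositional, $k\in\mathbb N$) by closing under $\wedge,\vee$ and under prefixing $\diamond^{\ge k},\blacksquare^{<k},\diamond^{=k},\blacksquare^{\ne k}$. Semantics at a point $w$: Boolean connectives as usual; $\diamond^{\ge k}\varphi$ (resp. $\diamond^{=k}\varphi$) holds iff at least (resp. exactly) $k$ points of the domain satisfy $\varphi$; $\blacksquare^{<k}\varphi$ is equivalent to $\neg\diamond^{\ge k}\neg\varphi$ and $\blacksquare^{\ne k}\varphi$ to $\neg\diamond^{=k}\neg\varphi$.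 Truth of a $\mathrm{GMLU}$-formula in a model does not depend on the point, so $\mathfrak M\vDash\varphi$ is well defined. $\mathrm{GMLU}_d$ is the set of formulas of counting depth at most $d$, i.e. in which every occurring $\diamond^{\ge k},\blacksquare^{<k}$ has $k\le d$ and every occurring $\diamond^{=k},\blacksquare^{\ne k}$ has $k+1\le d$. $\mathfrak M\equiv_d\mathfrak N$ iff $\mathfrak M,\mathfrak N\in\mathcal M$ satisfy the same $\mathrm{GMLU}_d$-formulas. A majority class is an equivalence class of $\equiv_d$ containing more than half of all models in $\mathcal M$. *)

(* Defs.v *)
From HB Require Import structures.
From mathcomp Require Import all_boot all_order all_algebra.
From mathcomp Require Import reals exp trigo.
Set Implicit Arguments.
Unset Strict Implicit.
Unset Printing Implicit Defensive.
Import Order.TTheory GRing.Theory Num.Theory.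

Inductive prop_form (tau : Type) : Type :=
| PSym of tau
| PNeg of tau
| PAnd of prop_form tau & prop_form tau
| POr of prop_form tau & prop_form tau.

(* The shapes of the prefixes dia^{>=k}, box^{<k}, dia^{=k}, box^{<>k}. *)
Inductive modality : Type := DiaGe | BoxLt | DiaEq | BoxNe.

(* The prefix (m, k) may be applied to a propositional formula or to a
   GMLU-formula; propositional formulas themselves are not GMLU-formulas. *)
Inductive gmlu (tau : Type) : Type :=
| GBase of modality & nat & prop_form tau
| GMod of modality & nat & gmlu tau
| GAnd of gmlu tau & gmlu tau
| GOr of gmlu tau & gmlu tau.

(* Models with domain of size n; the domain {1, ..., n} is encoded as 'I_n. *)
Notation model tau n := {ffun tau -> {set 'I_n}}.

Section Semantics.
Variables (tau : finType) (n : nat).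
Implicit Types (M N : model tau n) (w : 'I_n).

Fixpoint psat M w (psi : prop_form tau) : bool :=
  match psi with
  | PSym p => w \in M p
  | PNeg p => w \notin M p
  | PAnd a b => psat M w a && psat M w b
  | POr a b => psat M w a || psat M w b
  end.

Definition modality_holds (m : modality) (k : nat) (P : 'I_n -> bool) : bool :=
  match m with
  | DiaGe => k <= #|[set v | P v]|
  | BoxLt => ~~ (k <= #|[set v | ~~ P v]|)
  | DiaEq => #|[set v | P v]| == k
  | BoxNe => ~~ (#|[set v | ~~ P v]| == k)
  end.

Fixpoint gsat M w (phi : gmlu tau) : bool :=
  match phi with
  | GBase m k psi => modality_holds m k (fun v => psat M v psi)
  | GMod m k a => modality_holds m k (fun v => gsat M v a)
  | GAnd a b => gsat M w a && gsat M w b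
  | GOr a b => gsat M w a || gsat M w b
  end.

(* Truth of a GMLU-formula does not depend on w, so for n > 0 quantifying
   universally or existentially over w makes no difference. *)
Definition models M (phi : gmlu tau) : Prop := forall w, gsat M w phi.

Definition modality_depth (m : modality) (k : nat) : nat :=
  match m with
  | DiaGe | BoxLt => k
  | DiaEq | BoxNe => k.+1
  end.

Fixpoint gmlu_depth_le (d : nat) (phi : gmlu tau) : bool :=
  match phi with
  | GBase m k _ => modality_depth m k <= d
  | GMod m k a => (modality_depth m k <= d) && gmlu_depth_le d a
  | GAnd a b | GOr a b => gmlu_depth_le d a && gmlu_depth_le d b
  end.

Definition gmlu_equiv (d : nat) M N : Prop :=
  forall phi : gmlu tau, gmlu_depth_le d phi -> models M phi <-> models N phi.

Definition is_gmlu_class (d : nat) (C : {set model tau n}) : Prop :=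
  exists M, forall N, N \in C <-> gmlu_equiv d M N.

Definition has_majority_class (d : nat) : Prop :=
  exists2 C : {set model tau n},
    is_gmlu_class d C & #|[set: model tau n]| < 2 * #|C|.

End Semantics.

Arguments has_majority_class tau n d : clear implicits.

Local Open Scope ring_scope.

Definition c1 (R : realType) (t : R) : R :=
  1 / t * Num.sqrt (2 * t * ln (2 * t)).

Definition c2 (R : realType) (t : R) : R :=
  Num.sqrt (pi / (2 * t ^+ 3 * (4 * t) `^ (1 / (t - 1)))).

(* Main.v *)
Require Import Defs.
From HB Require Import structures.
From mathcomp Require Import all_boot all_order all_algebra.
From mathcomp Require Import zify ring lra.
From mathcomp Require Import perm.
From mathcomp Require Import reals topology normedtype sequences exp trigo.
Set Implicit Arguments.
Unset Strict Implicit.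
Unset Printing Implicit Defensive.
Import Order.TTheory GRing.Theory Num.Theory numFieldNormedType.Exports.
Local Open Scope ring_scope.

(** Call the set of symbols true at a point its type; there are t types. The
    formulas of counting depth at most d see exactly the numbers of points of
    each type, capped at d (gmlu_equiv_cap), so a class of the equivalence is a
    set of models with prescribed capped type counts. In a uniformly random
    model the types of the n points are independent and uniform.

    Small d: the class of the models in which every type occurs at least d
    times is a majority class. A type occurs fewer than d times with
    probability below 1/(2t), by the exponential moment method (lower_tail),
    and there are t types; c1 is the deviation that makes this bound 1/(2t).

    Large d: take any class. If some type count takes a single value on the
    class, exchange that type with another one at the first point that has
    either of them. This involution moves the count by one, hence moves the
    class off itself, and the class contains at most half of the models
    (card_fixed_count_le). Otherwise every type occurs at least d times, and
    e = n - t d is positive. Half of the types contain a given symbol p, so the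
    number of points where p is true lies in an interval of e + 1 values. That
    number is binomially distributed with parameters n and 1/2, and the class
    has probability at most (e + 1) max_j C(n, j) / 2^n (card_between_le).
    The hypothesis on d gives e <= t c2 sqrt n, that is
    e^2 <= pi n / (2 t q) with q = (4 t)^(1 / (t - 1)) (gap_sqr_le). Since
    pi <= 10/3 and t q >= 10 this yields 6 e^2 <= n, and a central binomial
    estimate bounds the probability by 1/2 if e >= 2. For e = 1 the number n
    is odd, and at least 9, which is just enough (bin_concentration). *)

(** * Types of points and the logic *)

Section Types.
Local Open Scope nat_scope.
Variables (tau : finType) (n : nat).
Implicit Types (M N : model tau n) (w : 'I_n) (a : {set tau}).

(** Reading a model pointwise turns a random model into independent uniform
    types. *)
Definition types M : {ffun 'I_n -> {set tau}} := [ffun w => [set p | w \in M p]].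

Definition tcount M a : nat := #|[set w | types M w == a]|.

Definition cap_equiv d M N : bool :=
  [forall a, minn d (tcount M a) == minn d (tcount N a)].

Lemma types_bij : bijective types.
Proof.
exists (fun f : {ffun 'I_n -> {set tau}} => [ffun p => [set w | p \in f w]]).
- by move=> M; apply/ffunP=> p; apply/setP=> w; rewrite ffunE inE ffunE inE.
- by move=> f; apply/ffunP=> w; apply/setP=> p; rewrite ffunE inE ffunE inE.
Qed.

Lemma card_types_pred (Q : pred {set tau}) M :
  #|[set w | Q (types M w)]| = \sum_(a | Q a) tcount M a.
Proof.
rewrite -sum1_card (partition_big (types M) Q) /=; last by move=> w; rewrite inE.
apply: eq_bigr => a Qa; rewrite /tcount -sum1_card; apply: eq_bigl => w.
by rewrite !inE andbC; case: eqP => // ->; rewrite Qa.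
Qed.

Lemma sum_tcount M : \sum_a tcount M a = n.
Proof.
rewrite -(card_types_pred predT M) -[RHS]card_ord -cardsT.
by apply: eq_card => w; rewrite !inE.
Qed.

(** Capped type counts determine the capped count of every union of types. *)
Lemma minn_sum d (I : finType) (P : pred I) (F : I -> nat) :
  minn d (\sum_(i | P i) F i) = minn d (\sum_(i | P i) minn d (F i)).
Proof.
elim/big_rec2: _ => // i x y _ IH.
lia.
Qed.

Lemma cap_equiv_pred d M N (Q : pred {set tau}) : cap_equiv d M N ->
  minn d #|[set w | Q (types M w)]| = minn d #|[set w | Q (types N w)]|.
Proof.
move=> /forallP MN; rewrite !card_types_pred minn_sum [RHS]minn_sum.
by congr minn; apply: eq_bigr => a _; apply/eqP.
Qed.

Fixpoint tsat (psi : prop_form tau) a : bool :=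
  match psi with
  | PSym p => p \in a
  | PNeg p => p \notin a
  | PAnd x y => tsat x a && tsat y a
  | POr x y => tsat x a || tsat y a
  end.

Lemma psat_tsat psi M w : psat M w psi = tsat psi (types M w).
Proof. by elim: psi => /= [p|p|x -> y ->|x -> y ->] //; rewrite ffunE inE. Qed.

Lemma modality_holds_cap d m k (P Q : 'I_n -> bool) :
    modality_depth m k <= d ->
    minn d #|[set w | P w]| = minn d #|[set w | Q w]| ->
    minn d #|[set w | ~~ P w]| = minn d #|[set w | ~~ Q w]| ->
  modality_holds m k P = modality_holds m k Q.
Proof. case: m => /= kd PQ NPQ; lia. Qed.

(** A modality compares a count, or the count of the complement, with a bound
    that the cap d cannot blur; a nested formula has the same value at all
    points, so the modality in front of it counts the same number in both
    models. *)
Lemma cap_equiv_gsat d M N : cap_equiv d M N ->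
  forall phi, gmlu_depth_le d phi -> forall w v, gsat M w phi = gsat N v phi.
Proof.
move=> MN; elim=> /= [m k psi kd w v|m k x IH /andP[kd xd] w v|x IHx y IHy|x IHx y IHy].
- apply: modality_holds_cap kd _ _.
  + have := cap_equiv_pred (tsat psi) MN.
    by congr (minn _ _ = minn _ _); apply: eq_card => u; rewrite !inE psat_tsat.
  + have := cap_equiv_pred (fun a => ~~ tsat psi a) MN.
    by congr (minn _ _ = minn _ _); apply: eq_card => u; rewrite !inE psat_tsat.
- apply: modality_holds_cap kd _ _; congr minn; apply: eq_card => u;
  by rewrite !inE (IH xd u u).
- by move=> /andP[xd yd] w v; rewrite (IHx xd w v) (IHy yd w v).
- by move=> /andP[xd yd] w v; rewrite (IHx xd w v) (IHy yd w v).
Qed.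

(** The characteristic formula of a type. Propositional formulas have no
    constants, so a tautology on p0 ends the conjunction. *)
Definition type_form (p0 : tau) a : prop_form tau :=
  foldr (fun p psi => PAnd (if p \in a then PSym p else PNeg p) psi)
        (POr (PSym p0) (PNeg p0)) (enum tau).

Lemma tsat_type_form p0 a b : tsat (type_form p0 a) b = (b == a).
Proof.
have -> : tsat (type_form p0 a) b = all (fun p => (p \in b) == (p \in a)) (enum tau).
  rewrite /type_form; elim: (enum tau) => /= [|p s ->]; first exact: orbN.
  by case: (p \in a) => /=; case: (p \in b).
apply/allP/eqP => [ab|-> //]; apply/setP=> p.
by apply/eqP/ab; rewrite mem_enum.
Qed.

(** Conversely, requiring at least k points of a given type, for all k up to d,
    pins down the capped count of that type. *)
Lemma gmlu_equiv_cap d M N : 0 < #|tau| -> 0 < n ->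
  gmlu_equiv d M N <-> cap_equiv d M N.
Proof.
move=> /card_gt0P[p0 _] n0; split=> [MN|MN phi phid]; last first.
  by split=> sat w; move: (sat w); rewrite (cap_equiv_gsat MN phid w w).
have sat_dia (L : model tau n) k a :
    models L (GBase DiaGe k (type_form p0 a)) <-> k <= tcount L a.
  have -> : tcount L a = #|[set w | psat L w (type_form p0 a)]|.
    by apply: eq_card => w; rewrite !inE psat_tsat tsat_type_form.
  by split=> [/(_ (Ordinal n0))|kL w].
apply/forallP=> a; apply/eqP.
have le_iff k : k <= d -> (k <= tcount M a) = (k <= tcount N a).
  by move=> kd; apply/idP/idP => /sat_dia sat; apply/sat_dia;
    apply/(MN (GBase DiaGe k (type_form p0 a)) kd).
have [le1 le2] := (le_iff (minn d (tcount M a)) (geq_minl _ _),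
                   le_iff (minn d (tcount N a)) (geq_minl _ _)).
lia.
Qed.

(** Complementation exchanges the types containing p with the others. *)
Lemma card_sets_mem (p : tau) : #|{set tau}| = 2 * #|[set a : {set tau} | p \in a]|.
Proof.
rewrite -cardsT -(cardsID [set a : {set tau} | p \in a] setT) setTI mul2n -addnn.
congr (_ + _); rewrite -[RHS](card_imset _ (@setC_inj tau)); apply: eq_card => a.
rewrite setTD; apply/idP/imsetP => [|[b]]; rewrite !inE.
  by move=> pa; exists (~: a); rewrite ?setCK ?inE.
by move=> pb ->; rewrite inE pb.
Qed.

(** The interpretation of one symbol in a uniform model is a uniform set;
    clearing denominators avoids probabilities. *)
Lemma card_model_fiber (p : tau) (D : {set {set 'I_n}}) :
  #|[set M : model tau n | M p \in D]| * 2 ^ n = #|D| * #|[set: model tau n]|.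
Proof.
have card_pow : #|{set 'I_n}| = 2 ^ n.
  by rewrite -[LHS]cardsT -powersetT card_powerset cardsT card_ord.
pose F q : {pred {set 'I_n}} := [pred S | (q == p) ==> (S \in D)].
have card_F q : #|F q| = if q == p then #|D| else 2 ^ n.
  by rewrite -card_pow; case: ifP => qp; apply: eq_card => S; rewrite !inE qp.
have -> : #|[set M : model tau n | M p \in D]| = #|family F|.
  apply: eq_card => M; rewrite inE; apply/idP/familyP => [MD q|/(_ p)].
    by rewrite inE; apply/implyP => /eqP->.
  by rewrite inE eqxx.
rewrite (card_family F) foldrE big_map big_enum /= (bigD1 p) //= card_F eqxx.
rewrite cardsT card_ffun card_pow -mulnA; congr (_ * _).
rewrite -prod_nat_const [RHS](bigD1 p) //= mulnC; congr (_ * _).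
by apply: eq_bigr => q /negbTE qp; rewrite card_F qp.
Qed.

End Types.

(** * Exchanging two types at one point *)

Section Flip.
Local Open Scope nat_scope.
Variables (T : finType) (n : nat) (a b : T).
Implicit Types f g : {ffun 'I_n -> T}.

Definition flip f : {ffun 'I_n -> T} :=
  if [pick w | f w \in pred2 a b] is Some w0
  then [ffun w => if w == w0 then tperm a b (f w) else f w] else f.

Lemma tperm_pred2 x : (tperm a b x \in pred2 a b) = (x \in pred2 a b).
Proof.
by rewrite !inE; case: tpermP => [->|->|/eqP/negbTE-> /eqP/negbTE->]; rewrite ?eqxx ?orbT.
Qed.

Lemma flip_pred2 f w : (flip f w \in pred2 a b) = (f w \in pred2 a b).
Proof.
rewrite /flip; case: pickP => [w0 _|//].
by rewrite ffunE; case: eqP => [_|//]; rewrite tperm_pred2.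
Qed.

(** The flip does not change which points have a type in {a, b}, so a second
    flip selects the same point. *)
Lemma flipK : involutive flip.
Proof.
move=> f; rewrite {1}/flip (eq_pick (flip_pred2 f)) /flip.
case: pickP => // w0 _; apply/ffunP => w; rewrite !ffunE.
by case: eqP => // _; rewrite tpermK.
Qed.

Lemma flip_card f : a != b -> (exists w, f w \in pred2 a b) ->
  #|[set w | flip f w == a]| != #|[set w | f w == a]|.
Proof.
move=> ab [w fw]; rewrite /flip; case: pickP => [w0 fw0|/(_ w)]; last by rewrite fw.
rewrite (cardsD1 w0) [X in _ != X](cardsD1 w0) !inE ffunE eqxx.
have -> : [set w | [ffun w => if w == w0 then tperm a b (f w) else f w] w == a] :\ w0
        = [set w | f w == a] :\ w0.
  by apply/setP=> v; rewrite !inE ffunE; case: eqP.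
rewrite eqn_add2r; have ba : (b == a) = false by rewrite eq_sym (negbTE ab).
by case/orP: fw0 => /eqP->; rewrite ?tpermL ?tpermR eqxx ba.
Qed.

(** A set of functions on which the count of a is constant is disjoint from its
    image under the flip. *)
Lemma card_le_half_flip (A : {set {ffun 'I_n -> T}}) k : a != b ->
    {in A, forall f, exists w, f w \in pred2 a b} ->
    {in A, forall f, #|[set w | f w == a]| = k} ->
  2 * #|A| <= #|{ffun 'I_n -> T}|.
Proof.
move=> ab Aab Ak; have : [disjoint A & [set flip f | f in A]].
  rewrite disjoint_sym; apply/pred0P => g; apply/negP => /andP[/imsetP[f fA ->] ffA].
  by have := flip_card ab (Aab f fA); rewrite (Ak _ ffA) (Ak _ fA) eqxx.
rewrite -leq_card_setU => /eqP AU.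
rewrite mul2n -addnn -{2}(card_imset _ (inv_inj flipK)) -AU.
exact: max_card.
Qed.

End Flip.


(** * Central binomial coefficients *)

Section Binomial.
Local Open Scope nat_scope.

(** The linear factor 3 k + 1 is what makes the induction close: the step needs
    (2k+1)^2 (3k+4) <= 4 (k+1)^2 (3k+1). *)
Lemma central_bin_bound k : 'C(k.*2, k) ^ 2 * (3 * k + 1) <= 16 ^ k.
Proof.
elim: k => [|k IH]; first by rewrite bin0.
have step : k.+1 * 'C(k.+1.*2, k.+1) = 2 * (k.*2.+1) * 'C(k.*2, k).
  have h1 : k.+1 * 'C(k.+1.*2, k.+1) = k.+1.*2 * 'C(k.*2.+1, k).
    by rewrite doubleS -mul_bin_diag.
  have h2 : k.+1 * 'C(k.*2.+1, k) = k.*2.+1 * 'C(k.*2, k).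
    have := mul_bin_down k.*2.+1 k; rewrite /= => ->; congr (_ * _); lia.
  by rewrite h1 -mul2n -!mulnA h2.
have k0 : 0 < k.+1 ^ 2 by rewrite expn_gt0.
rewrite -(leq_pmul2l k0) mulnA -expnMn step expnMn (expnS 16).
have poly : (2 * k.*2.+1) ^ 2 * (3 * k.+1 + 1) <= k.+1 ^ 2 * 16 * (3 * k + 1) by lia.
move: (leq_mul poly (leqnn ('C(k.*2, k) ^ 2))) (leq_mul (leqnn (k.+1 ^ 2 * 16)) IH).
by move: (16 ^ k) ('C(k.*2, k) ^ 2) ((2 * k.*2.+1) ^ 2) (k.+1 ^ 2) => p c x y; lia.
Qed.

Lemma bin_le_half n j : 'C(n, j) <= 'C(n, uphalf n).
Proof.
have mono i m : i + m <= uphalf n -> 'C(n, i) <= 'C(n, i + m).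
  elim: m => [|m IH] im; first by rewrite addn0.
  apply: leq_trans (IH _) _; first lia.
  have := mul_bin_left n (i + m); rewrite addnS => eq.
  have le : (i + m).+1 <= n - (i + m) by lia.
  by rewrite -(leq_pmul2l (ltn0Sn (i + m))) eq leq_mul2r le orbT.
have [jn|nj] := leqP j (uphalf n).
  by rewrite -(subnKC jn) mono // subnKC.
have [jn|nj'] := leqP j n; last by rewrite bin_small.
rewrite -bin_sub //; have le : n - j <= uphalf n by lia.
by rewrite -(subnKC le) mono // subnKC.
Qed.

(** For odd n the largest coefficient is half of the central one in the next
    row, whence the better additive constant. *)
Lemma bin_bound n j : 'C(n, j) ^ 2 * (3 * n + (if odd n then 5 else 2)) <= 2 * 4 ^ n.
Proof.
apply: (@leq_trans ('C(n, uphalf n) ^ 2 * (3 * n + (if odd n then 5 else 2)))).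
  by rewrite leq_mul2r leq_exp2r ?bin_le_half ?orbT.
have pow k : 16 ^ k = 4 ^ k.*2 by rewrite -mul2n expnM.
have := central_bin_bound (uphalf n); rewrite pow.
case: ifP => on; last first.
  rewrite even_uphalfK ?on // => cb; have -> : 3 * n + 2 = 2 * (3 * uphalf n + 1) by lia.
  by move: ('C(n, _) ^ 2) (4 ^ n) cb => x y; lia.
rewrite odd_uphalfK // => cb; have -> : 3 * n + 5 = 2 * (3 * uphalf n + 1) by lia.
have sym : 'C(n.+1, uphalf n) = 2 * 'C(n, uphalf n).
  have -> : uphalf n = (uphalf n).-1.+1 by lia.
  rewrite binS mul2n -addnn -[X in _ + X]bin_sub; last lia.
  by congr (_ + 'C(_, _)); lia.
move: cb; rewrite sym expnMn (expnS 4).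
by move: ('C(n, _) ^ 2) (4 ^ n) => x y; lia.
Qed.

(** For e >= 2 the inequality 8 (e+1)^2 <= 18 e^2 suffices. For e = 1 the case
    n = 9 is tight for the bound on odd rows: 8 * 4 = 3 * 9 + 5. *)
Lemma bin_concentration n e j :
    (e = 1 -> odd n /\ 9 <= n) -> (2 <= e -> 6 * e ^ 2 <= n) -> 0 < e ->
  2 * ((e + 1) * 'C(n, j)) <= 2 ^ n.
Proof.
move=> e1 e2 e0; rewrite -leq_sqr !expnMn.
have -> : (2 ^ n) ^ 2 = 4 ^ n by rewrite -expnM mulnC expnM.
have := bin_bound n j; move: ('C(n, j) ^ 2) (4 ^ n) => x y.
have [/[dup] le2 /e2 len|lt2] := leqP 2 e.
  have en : 8 * (e + 1) ^ 2 <= 3 * n by nia.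
  move: (leq_mul (leqnn x) en) => xen h.
  have {}h : x * (3 * n) <= 2 * y by apply: leq_trans h; rewrite leq_mul2l leq_addr orbT.
  by move: ((e + 1) ^ 2) xen => z; lia.
have E1 : e = 1 by lia.
have [-> n9] := e1 E1; rewrite E1 => h.
have : x * 32 <= x * (3 * n + 5) by rewrite leq_mul2l; apply/orP; right; lia.
lia.
Qed.

End Binomial.

(** * Classes with at most half of the models *)

Section NoMajority.
Local Open Scope nat_scope.
Variables (tau : finType) (n : nat).
Implicit Types (M N : model tau n) (a : {set tau}).

Lemma card_sets_between m e :
  #|[set S : {set 'I_n} | m <= #|S| <= m + e]| = \sum_(i < e.+1) 'C(n, m + i).
Proof.
have inordE (i : 'I_e.+1) s :
    (m <= s <= m + e) && (inord (s - m) == i) = (s == m + i).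
  have := ltn_ord i; rewrite -(inj_eq val_inj) /= => ie.
  have [ms|ms] := boolP (m <= s <= m + e); last by apply/esym/negbTE; lia.
  by rewrite inordK; lia.
rewrite -sum1_card (partition_big (fun S : {set 'I_n} => inord (#|S| - m) : 'I_e.+1) predT) //=.
apply: eq_bigr => i _; rewrite -[X in 'C(X, _)]card_ord -card_draws -sum1_card.
by apply: eq_bigl => S; rewrite !inE; apply: inordE.
Qed.

Lemma card_between_le (p : tau) m e :
    (forall j, 2 * ((e + 1) * 'C(n, j)) <= 2 ^ n) ->
  2 * #|[set M : model tau n | m <= #|M p| <= m + e]| <= #|[set: model tau n]|.
Proof.
move=> bin; set K := [set M | _].
have -> : K = [set M : model tau n | M p \in [set S : {set 'I_n} | m <= #|S| <= m + e]].
  by apply/setP=> M; rewrite !inE.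
rewrite -(@leq_pmul2r (2 ^ n)) ?expn_gt0 // -mulnA card_model_fiber mulnA [leqRHS]mulnC.
rewrite leq_mul2r card_sets_between; apply/orP; right.
pose B := \max_(i < e.+1) 'C(n, m + i).
have [i0 _ Bi0] : {i0 : 'I_e.+1 | true & B = 'C(n, m + i0)}.
  by apply: eq_bigmax_cond; rewrite cardT size_enum_ord.
apply: leq_trans (bin (m + i0)); rewrite leq_mul2l /= -Bi0.
rewrite addn1 -[X in X * B](card_ord e.+1) -sum_nat_const.
by apply: leq_sum => i _; rewrite /B (bigD1 i) //= leq_maxl.
Qed.

(** The flip needs a point of type a or b; hence the positivity hypothesis. *)
Lemma card_fixed_count_le (K : {set model tau n}) a b k : a != b ->
    {in K, forall M, tcount M a = k /\ 0 < tcount M a + tcount M b} ->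
  2 * #|K| <= #|[set: model tau n]|.
Proof.
move=> ab HK; have [g gK _] := types_bij tau n.
have inj : injective (@types tau n) := can_inj gK.
rewrite -(card_imset _ inj) cardsT.
have -> : #|{: model tau n}| = #|{ffun 'I_n -> {set tau}}|.
  exact: bij_eq_card (types_bij tau n).
apply: (card_le_half_flip ab) => [f /imsetP[M MK ->]|f /imsetP[M MK ->]].
  have [_] := HK M MK; rewrite addn_gt0 => /orP[] /card_gt0P[w]; rewrite inE => wa;
  by exists w; rewrite !inE wa ?orbT.
exact: (HK M MK).1.
Qed.

(** Half of the types contain p and half do not; each half accounts for at
    least h d points, where h is the number of types in it. *)
Lemma types_count_bounds M (p : tau) d :
    (forall a, d <= tcount M a) ->
  #|[set a : {set tau} | p \in a]| * d <= #|M p| <=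
    n - #|[set a : {set tau} | p \in a]| * d.
Proof.
move=> dM; set h := #|_|.
have Mp : #|M p| = \sum_(a : {set tau} | p \in a) tcount M a.
  by rewrite -card_types_pred; apply: eq_card => w; rewrite inE ffunE inE.
have hd : h * d <= #|M p|.
  rewrite Mp /h -sum_nat_const (eq_bigl (fun a : {set tau} => p \in a)).
    exact: leq_sum.
  by move=> a; rewrite inE.
have := sum_tcount M; rewrite (bigID (fun a : {set tau} => p \in a)) /= -Mp.
have hd' : h * d <= \sum_(a : {set tau} | p \notin a) tcount M a.
  have -> : h = #|[set a : {set tau} | p \notin a]|.
    have := card_sets_mem p; rewrite -/h -[#|{set tau}|]cardsT.
    rewrite -(cardsID [set a : {set tau} | p \in a] setT) setTI -/h setTD.
    have -> : ~: [set a : {set tau} | p \in a] = [set a : {set tau} | p \notin a].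
      by apply/setP=> a; rewrite !inE.
    lia.
  rewrite -sum_nat_const (eq_bigl (fun a : {set tau} => p \notin a)).
    exact: leq_sum.
  by move=> a; rewrite inE.
by move=> sumE; rewrite hd -[X in X - _]sumE -addnBA ?leq_addr.
Qed.

(** A type count is constant on the class if it is below d for one model, or if
    n = t d, which forces all counts to be d. One of the two types exchanged
    is taken among those that occur, so that there is a point to flip. *)
Lemma no_majority d (t := #|{set tau}|) : 0 < #|tau| -> 0 < n -> 0 < d ->
    (t * d + 1 = n -> odd n /\ 9 <= n) ->
    (forall e, t * d + e = n -> 2 <= e -> 6 * e ^ 2 <= n) ->
  ~ has_majority_class tau n d.
Proof.
move=> /[dup] tau0 /card_gt0P[p _] n0 d0 e1 e2 [C [M0 CM0]].
set K := [set N | cap_equiv d M0 N].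
have CK : C \subset K.
  by apply/subsetP => N /CM0/(gmlu_equiv_cap _ _ _ tau0 n0); rewrite inE.
apply/negP; rewrite -leqNgt; apply: leq_trans (_ : 2 * #|K| <= _).
  by rewrite leq_mul2l subset_leq_card.
have capK N a : N \in K -> minn d (tcount M0 a) = minn d (tcount N a).
  by rewrite inE => /forallP/(_ a)/eqP.
have [b b0] : exists b, 0 < tcount M0 b.
  apply/existsP; move: n0; apply: contraLR; rewrite negb_exists => /forallP M00.
  rewrite -(sum_tcount M0) big1 // => a _; apply/eqP.
  by rewrite -leqn0 leqNgt M00.
have fixed a : {in K, forall N, tcount N a = tcount M0 a} -> 2 * #|K| <= #|[set: model tau n]|.
  move=> aK; have [c ac ac0] : exists2 c, a != c & 0 < tcount M0 a + tcount M0 c.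
    have [ab|] := eqVneq a b; last by exists b => //; lia.
    exists (~: a); last by rewrite ab; lia.
    by apply/eqP => /setP/(_ p); rewrite inE; case: (p \in a).
  apply: (@card_fixed_count_le _ a c (tcount M0 a) ac) => N NK.
  have := capK N c NK; rewrite (aK N NK); lia.
have [/forallP big|] := boolP [forall a, d <= tcount M0 a]; last first.
  rewrite negb_forall => /existsP[a ad]; apply: (fixed a) => N /(capK _ a).
  lia.
have bigK N a : N \in K -> d <= tcount N a.
  by move=> /(capK _ a); have := big a; lia.
have td : t * d <= n.
  by rewrite -(sum_tcount M0) /t -sum_nat_const; apply: leq_sum.
have [tdn|tdn] := eqVneq (t * d) n.
  have exact N : N \in K -> forall a, tcount N a = d.
    move=> NK a; apply/eqP; rewrite eq_sym.
    have : \sum_(c : {set tau}) d == \sum_c tcount N c.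
      by rewrite sum_nat_const sum_tcount -tdn.
    by rewrite (eq_leqif (leqif_sum (fun c _ => leqif_eq (bigK N c NK)))) => /forallP/(_ a).
  apply: (fixed set0) => N NK; rewrite (exact N NK) (exact M0) // inE.
  by apply/forallP.
pose h := #|[set a : {set tau} | p \in a]|.
have th : t = 2 * h := card_sets_mem p.
apply: leq_trans (card_between_le p (h * d) (e := n - t * d) _).
  rewrite leq_mul2l /=; apply/subset_leq_card/subsetP => N NK; rewrite inE.
  have := types_count_bounds p (fun a => bigK N a NK); rewrite -/h th => /andP[-> le]; apply: leq_trans le _; lia.
move=> j; apply: bin_concentration; last lia.
  by move=> ?; apply: e1; lia.
by move=> ?; apply: e2 => //; lia.
Qed.

End NoMajority.

(** * Analytic estimates *)

Section Tail.
Variable R : realType.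
Implicit Types x y : R.

Lemma expR_ge_quadratic x : 0 <= x -> 1 + x + x ^+ 2 / 2 <= expR x.
Proof.
move=> x0; rewrite /expR.
have -> : 1 + x + x ^+ 2 / 2 = series (exp_coeff x) 3.
  rewrite /series /= !big_nat_recr //= big_nil /exp_coeff /= add0r.
  by rewrite expr0 expr1 !fact0 !divr1.
apply: nondecreasing_cvgn_le (is_cvg_series_exp_coeff x) _.
apply/nondecreasing_seqP => k; rewrite /series /= big_nat_recr //= lerDl.
by rewrite /exp_coeff /= divr_ge0 // exprn_ge0.
Qed.

Lemma expRN_le_quadratic x : 0 <= x -> expR (- x) <= 1 - x + x ^+ 2 / 2.
Proof.
move=> x0; have := expR_ge_quadratic x0; have := expR_gt0 x => e0 e1.
rewrite expRN -(ler_pM2l e0) mulfV ?gt_eqF //.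
apply: (@le_trans _ _ ((1 + x + x ^+ 2 / 2) * (1 - x + x ^+ 2 / 2))).
  by have := sqr_ge0 (x ^+ 2); nra.
rewrite ler_wpM2r //; nra.
Qed.

(** The cosine is negative at 5/3: its alternating series stays below the
    partial sum 1 - x^2/2 + x^4/24, which is negative there. *)
Lemma pi_le_10_3 : (pi : R) <= 10 / 3.
Proof.
suff : cos (5 / 3 : R) < 0.
  apply: contraTT; rewrite -ltNge -leNgt => pi_gt; apply/ltW/cos_gt0_pihalf.
  by apply/andP; split; lra.
rewrite -(opprK (cos _)) oppr_lt0; have /cvgN h := @cvg_cos_coeff' R (5 / 3).
rewrite -(cvg_lim (@Rhausdorff R) h).
apply: (@lt_trans _ _ (\sum_(0 <= i < 3) - cos_coeff' (5 / 3 : R) i)).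
  rewrite !big_nat_recr //= big_nil /cos_coeff' add0r.
  rewrite !expr0z expr1z -[(-1) ^ 2]/((-1) ^+ 2) sqrrN expr1n !mul1r mulN1r.
  rewrite -[0.*2]/0%N -[1.*2]/2%N -[2.*2]/4%N fact0 -[2`!]/2%N -[4`!]/24%N.
  lra.
rewrite -seriesN lt_sum_lim_series //.
  by move/cvgP in h; by rewrite seriesN.
move=> d; rewrite /cos_coeff'.
have -> : (-1 : R) ^ (3 + d.*2)%N = -1 by rewrite -exprnP -signr_odd oddD odd_double.
have -> : (-1 : R) ^ (3 + d.*2.+1)%N = 1 by rewrite -exprnP -signr_odd oddD /= odd_double.
rewrite mul1r mulN1r mulNr opprK subr_gt0.
rewrite addnS doubleS -[X in _ ^+ X]addn2 exprD -mulrA.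
rewrite ltr_pM2l ?exprn_gt0 //; last lra.
rewrite factS factS 2!natrM mulrA invfM !mulrA.
set F := _`!%:R; have F0 : 0 < F by rewrite ltr0n fact_gt0.
rewrite -[ltRHS]mul1r ltr_pM2r ?invr_gt0 //.
set m := (_ + _).*2; rewrite -natrM.
rewrite ltr_pdivrMr ?ltr0n // mul1r.
have : 6%:R <= (m.+2 * m.+1)%N%:R :> R by rewrite ler_nat; nia.
lra.
Qed.

Variables (T : finType) (n : nat) (a : T).

(** The generating function of a binomial count factors over the points. *)
Lemma sum_pow_count x :
  \sum_(f : {ffun 'I_n -> T}) x ^+ #|[set w | f w == a]| = (x + #|T|.-1%:R) ^+ n.
Proof.
transitivity (\sum_(f : {ffun 'I_n -> T}) \prod_(w < n) (if f w == a then x else 1)).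
  apply: eq_bigr => f _; rewrite -big_mkcond /= -prodr_const.
  by apply: eq_bigl => w; rewrite inE.
rewrite -(bigA_distr_bigA (fun _ c => if c == a then x else 1)) prodr_const card_ord.
congr (_ ^+ _); rewrite (bigD1 a) //= eqxx -(cardC1 a) -sumr_const; congr (_ + _).
by apply: eq_bigr => c /negbTE ->.
Qed.

(** Exponential moment method for the lower tail of the number of points with
    value a, whose mean is n / t. The inequality is strict because the function
    that is constantly a contributes a positive term outside the tail. *)
Lemma lower_tail (d : nat) y (t : R := #|T|%:R) : (0 < n)%N -> 0 < y ->
    d%:R <= n%:R / t - y ->
  #|[set f : {ffun 'I_n -> T} | (#|[set w | f w == a]| < d)%N]|%:R
    * expR (y ^+ 2 * t / (2 * n%:R)) < t ^+ n.
Proof.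
move=> n0 y0 dle.
have N0 : 0 < n%:R :> R by rewrite ltr0n.
have T0 : (0 < #|T|)%N by apply/card_gt0P; exists a.
have t1 : 1 <= t by rewrite ler1n.
have t0 : 0 < t by lra.
(* the parameter s minimizes the quadratic exponent - s y + (n / t) s^2 / 2 *)
pose s := y * t / n%:R; pose x := expR (- s).
have s0 : 0 < s by rewrite divr_gt0 // mulr_gt0.
have x0 : 0 < x by exact: expR_gt0.
have x1 : x < 1 by rewrite /x expR_lt1; lra.
set L := [set f | _].
have dn : (d < n)%N.
  rewrite -(ltr_nat R); have : n%:R / t <= n%:R by rewrite ler_pdivrMr // ler_peMr // ltW.
  lra.
have markov : #|L|%:R * x ^+ d < (x + #|T|.-1%:R) ^+ n.
  rewrite -sum_pow_count (bigID (mem L)) /= -[ltLHS]addr0; apply: ler_ltD.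
    rewrite mulr_natl -sumr_const; apply: ler_sum => f; rewrite inE => /ltnW fd.
    by apply: ler_wiXn2l; rewrite ?ltW.
  pose f0 : {ffun 'I_n -> T} := [ffun=> a].
  have f0L : f0 \notin L.
    rewrite inE -leqNgt (_ : [set w | _] = setT) ?cardsT ?card_ord ?(ltnW dn) //.
    by apply/setP=> w; rewrite !inE ffunE eqxx.
  rewrite (bigD1 f0) //= ltr_pwDl ?exprn_gt0 //.
  by apply: sumr_ge0 => f _; rewrite exprn_ge0 ?ltW.
have mgf : (x + #|T|.-1%:R) ^+ n <= t ^+ n * expR (- ((1 - x) / t * n%:R)).
  have -> : x + #|T|.-1%:R = t * (1 - (1 - x) / t).
    rewrite mulrBr mulr1 mulrC divfK ?gt_eqF // /t -{2}(prednK T0) mulrS; ring.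
  rewrite exprMn ler_wpM2l ?exprn_ge0 ?(ltW t0) // -[X in expR X]mulNr expRM_natr.
  apply: lerXn2r; rewrite ?nnegrE ?expR_ge0 ?expR_ge1Dx //.
  by rewrite subr_ge0 ler_pdivrMr //; lra.
have xd : expR (- s * (n%:R / t - y)) <= x ^+ d.
  by rewrite /x -expRM_natr ler_expR; nra.
have x_le := expRN_le_quadratic (ltW s0); rewrite -/x in x_le.
have exponent : y ^+ 2 * t / (2 * n%:R) <= - s * (n%:R / t - y) + (1 - x) / t * n%:R.
  have -> : y ^+ 2 * t / (2 * n%:R) = - s * (n%:R / t - y) + (s - s ^+ 2 / 2) / t * n%:R.
    by rewrite /s; field; rewrite !gt_eqF.
  rewrite lerD2l ler_wpM2r ?ler0n // ler_wpM2r ?invr_ge0 ?(ltW t0) //; lra.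
rewrite -[ltRHS]mulr1 -[X in _ < _ * X](@expRxMexpNx_1 R ((1 - x) / t * n%:R)).
rewrite mulrCA [ltRHS]mulrC; apply: (@le_lt_trans _ _ (#|L|%:R * x ^+ d * expR ((1 - x) / t * n%:R))).
  rewrite -[leRHS]mulrA ler_wpM2l ?ler0n //.
  apply: (@le_trans _ _ (expR (- s * (n%:R / t - y)) * expR ((1 - x) / t * n%:R))).
    by rewrite -expRD ler_expR.
  by rewrite ler_wpM2r ?expR_ge0.
by rewrite ltr_pM2r ?expR_gt0 //; apply: lt_le_trans mgf.
Qed.
End Tail.

(** * The two thresholds *)

Section Thresholds.
Variable R : realType.

Let root_4t (t : R) : R := (4 * t) `^ (1 / (t - 1)).

Lemma c2_sqrE (t : R) : 1 < t -> (c2 t) ^+ 2 = pi / (2 * t ^+ 3 * root_4t t).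
Proof.
move=> t1; rewrite sqr_sqrtr // divr_ge0 ?pi_ge0 //.
by rewrite mulr_ge0 ?powR_ge0 // mulr_ge0 // exprn_ge0 //; lra.
Qed.

(** Raising both sides to the power T - 1 removes the root. *)
Lemma le_mul_root_4t (T : nat) (b : R) : (1 < T)%N -> 0 <= b ->
  b ^+ T.-1 <= 4 * T%:R ^+ T -> b <= T%:R * root_4t T%:R.
Proof.
case: T => [|[|k]] // _ b0 bT; set t : R := k.+2%:R.
have tk : t - 1 = k.+1%:R by rewrite /t [k.+2%:R]mulrS [1 + _]addrC addrK.
have t0 : 0 <= 4 * t by rewrite mulr_ge0 ?ler0n.
rewrite -(@ler_pXn2r _ k.+1) ?nnegrE // ?mulr_ge0 ?powR_ge0 ?ler0n //.
rewrite exprMn /root_4t -[X in _ * X]powR_mulrn ?powR_ge0 // -powRrM tk.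
by rewrite div1r mulVf ?pnatr_eq0 // powRr1 // mulrCA -exprSr.
Qed.

(** The number n - t d of points in excess of d per type is at most
    t c2 sqrt n, and its square has no root but q = (4 t)^(1 / (t - 1)), which
    any lower bound b of t q eliminates. *)
Lemma gap_sqr_le (n d : nat) (t b : R) : 1 < t -> 0 <= b -> b <= t * root_4t t ->
    n%:R / t - c2 t * Num.sqrt n%:R <= d%:R -> t * d%:R <= n%:R ->
  3 * b * (n%:R - t * d%:R) ^+ 2 <= 5 * n%:R.
Proof.
move=> t1 b0 bt dge dle.
have t0 : 0 < t by lra.
have q0 : 0 < root_4t t by apply: powR_gt0; lra.
set e := n%:R - t * d%:R; have e0 : 0 <= e by rewrite subr_ge0.
have e_le : e <= t * (c2 t * Num.sqrt n%:R).
  have : t * (n%:R / t - c2 t * Num.sqrt n%:R) <= t * d%:R by rewrite ler_pM2l.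
  by rewrite mulrBr [t * (n%:R / t)]mulrC divfK ?gt_eqF // /e; lra.
have : e ^+ 2 <= (t * (c2 t * Num.sqrt n%:R)) ^+ 2.
  by rewrite lerXn2r // nnegrE // (le_trans e0).
rewrite exprMn exprMn c2_sqrE // sqr_sqrtr ?ler0n // => esq.
have tq0 : 0 < t * root_4t t by rewrite mulr_gt0.
have : (t * root_4t t) * e ^+ 2 <= pi / 2 * n%:R.
  have -> : pi / 2 * n%:R =
      (t * root_4t t) * (t ^+ 2 * (pi / (2 * t ^+ 3 * root_4t t) * n%:R)).
    by field; rewrite !gt_eqF.
  by rewrite ler_pM2l.
have : b * e ^+ 2 <= t * root_4t t * e ^+ 2 by rewrite ler_wpM2r ?sqr_ge0.
have : pi / 2 * n%:R <= 10 / 3 / 2 * n%:R :> R.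
  by rewrite ler_wpM2r ?ler0n // ler_wpM2r ?pi_le_10_3 // invr_ge0.
lra.
Qed.

Lemma c2_lt_c1 (t : R) : 2 <= t -> c2 t < c1 t.
Proof.
move=> t2; have t0 : 0 < t by lra.
have q1 : 1 <= root_4t t.
  rewrite -(powRr0 (4 * t)); apply: ler_powR; first lra.
  by apply: divr_ge0 => //; lra.
have ln1 : 3 / 4 <= ln (2 * t).
  have pos : 0 < 2 * t by lra.
  have := expR_ge1Dx (- ln (2 * t)); rewrite expRN lnK // => h.
  have : (2 * t)^-1 <= 1 / 4 by rewrite div1r lef_pV2 ?posrE //; lra.
  lra.
rewrite /c1 -(ltr_pXn2r (n := 2)) ?nnegrE ?sqrtr_ge0 //; last first.
  by rewrite mulr_ge0 ?sqrtr_ge0 // divr_ge0 //; lra.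
rewrite c2_sqrE; last lra.
rewrite exprMn sqr_sqrtr; last by apply: mulr_ge0; lra.
rewrite ltr_pdivrMr; last by rewrite !mulr_gt0 ?exprn_gt0 //; lra.
have -> : (1 / t) ^+ 2 * (2 * t * ln (2 * t)) * (2 * t ^+ 3 * root_4t t)
        = 4 * ln (2 * t) * (t ^+ 2 * root_4t t) by field; rewrite gt_eqF.
have : pi < 4 :> R by have := pi_le_10_3 R; lra.
have : 4 <= t ^+ 2 * root_4t t by nra.
move=> h1 h2; nra.
Qed.

End Thresholds.

(** * Majority classes *)

Section Main.
Variables (R : realType) (tau : finType) (n : nat).
Hypotheses (tau0 : (0 < #|tau|)%N) (n0 : (0 < n)%N).
Let t : R := (2 ^ #|tau|)%N%:R.

Lemma card_types : #|{set tau}| = (2 ^ #|tau|)%N.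
Proof. by rewrite -[LHS]cardsT -powersetT card_powerset cardsT. Qed.

Lemma types_ge2 : 2 <= t.
Proof. by rewrite (ler_nat R 2) -{1}(expn1 2) leq_exp2l. Qed.

(** The union bound over the t types of lower_tail, whose exponential factor is
    exactly 2 t at the deviation c1 sqrt n. *)
Lemma majority_small_depth (d : nat) :
  d%:R <= n%:R / t - c1 t * Num.sqrt n%:R -> has_majority_class tau n d.
Proof.
move=> dle; have t2 := types_ge2.
set y := c1 t * Num.sqrt n%:R in dle.
have sn0 : 0 < Num.sqrt n%:R :> R by rewrite sqrtr_gt0 ltr0n.
have y0 : 0 < y.
  rewrite mulr_gt0 // (le_lt_trans _ (c2_lt_c1 t2)) //; exact: sqrtr_ge0.
pose L a := [set f : {ffun 'I_n -> {set tau}} | (#|[set w | f w == a]| < d)%N].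
have ysq : y ^+ 2 * t / (2 * n%:R) = ln (2 * t).
  rewrite /y exprMn sqr_sqrtr ?ler0n // /c1 exprMn sqr_sqrtr; last first.
    by rewrite mulr_ge0 ?ln_ge0 //; lra.
  have nn : n%:R != 0 :> R by rewrite pnatr_eq0 -lt0n.
  have tn : t != 0 by rewrite gt_eqF //; lra.
  by field; rewrite nn tn.
have tail a : (2 * #|{set tau}| * #|L a| < #|{ffun 'I_n -> {set tau}}|)%N.
  have := @lower_tail R {set tau} n a d y n0 y0.
  rewrite card_types -/t ysq lnK ?posrE; last lra.
  move=> /(_ dle); rewrite card_ffun card_ord card_types -(ltr_nat R) natrX -/t !natrM -/t.
  by rewrite mulrC.
pose C := [set M : model tau n | [forall a, d <= tcount M a]%N].
have [g gK _] := types_bij tau n.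
have inj : injective (@types tau n) := can_inj gK.
have cardE : #|[set: model tau n]| = #|{ffun 'I_n -> {set tau}}|.
  by rewrite cardsT; exact: bij_eq_card (types_bij tau n).
have CL : (#|~: C| <= \sum_(a : {set tau}) #|L a|)%N.
  rewrite -(card_imset _ inj).
  apply: leq_trans (_ : #|\bigcup_(a : {set tau}) L a| <= _)%N.
    apply/subset_leq_card/subsetP => f /imsetP[M]; rewrite !inE => MC ->.
    move: MC; rewrite negb_forall => /existsP[a ad]; apply/bigcupP; exists a => //.
    by rewrite inE ltnNge.
  elim/big_rec2: _ => [|a k A _ IH]; first by rewrite cards0.
  by apply: leq_trans (leq_card_setU _ _) _; rewrite leq_add2l.
have maj : (#|[set: model tau n]| < 2 * #|C|)%N.
  have CC := cardsC C; rewrite -cardsT in CC.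
  have : (2 * #|{set tau}| * #|~: C| < #|{set tau}| * #|[set: model tau n]|)%N.
    apply: leq_ltn_trans (_ : 2 * #|{set tau}| * (\sum_(a : {set tau}) #|L a|) < _)%N.
      by rewrite leq_mul2l CL orbT.
    rewrite big_distrr -sum_nat_const cardE /=.
    rewrite (bigD1 set0) //= [X in (_ < X)%N](bigD1 set0) //= -addSn leq_add //.
    by apply: leq_sum => a _; exact: ltnW.
  rewrite -mulnA mulnCA ltn_pmul2l; last by rewrite card_types expn_gt0.
  rewrite -CC; lia.
exists C => //.
have /card_gt0P[M MC] : (0 < #|C|)%N by lia.
exists M => N; rewrite gmlu_equiv_cap //.
move: MC; rewrite !inE => /forallP MC; split=> [/forallP NC|/forallP MN].
  by apply/forallP=> a; have := MC a; have := NC a; lia.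
by apply/forallP=> a; have := MC a; have /eqP := MN a; lia.
Qed.

(** The bound 10 <= t q, with q = (4 t)^(1 / (t - 1)), amounts to
    10^(t-1) <= 4 t^t. For e = 1 it gives only n >= 6; the residue of n modulo t
    raises this to 9 for t >= 4, and the exact value t q = 16 does so for
    t = 2. *)
Lemma no_majority_large_depth (d : nat) :
  n%:R / t - c2 t * Num.sqrt n%:R <= d%:R -> ~ has_majority_class tau n d.
Proof.
move=> dge; have t2 := types_ge2.
have bound (b : R) e : 0 <= b -> b ^+ (2 ^ #|tau|).-1 <= 4 * t ^+ (2 ^ #|tau|) ->
    (2 ^ #|tau| * d + e = n)%N -> 3 * b * e%:R ^+ 2 <= 5 * n%:R.
  move=> b0 bT en; have nE : n%:R = t * d%:R + e%:R by rewrite -en natrD natrM.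
  have -> : e%:R = n%:R - t * d%:R by rewrite nE addrC addKr.
  apply: gap_sqr_le dge _ => //; [lra| |by rewrite nE lerDl ler0n].
  by apply: le_mul_root_4t => //; rewrite -{1}(expn0 2) ltn_exp2l.
have b10 : 10 ^+ (2 ^ #|tau|).-1 <= 4 * t ^+ (2 ^ #|tau|).
  rewrite /t; case: #|tau| tau0 => [|[|[|[|k]]]] // _.
  - by rewrite -[(2 ^ 1)%N]/2%N; lra.
  - by rewrite -[(2 ^ 2)%N]/4%N; lra.
  - by rewrite -[(2 ^ 3)%N]/8%N; lra.
  have : (10 <= 2 ^ k.+4)%N by rewrite (@leq_trans (2 ^ 4)) // leq_exp2l.
  case: (2 ^ k.+4)%N => // T T10; rewrite /= exprS mulrA.
  have h : 10 ^+ T <= T.+1%:R ^+ T :> R by rewrite lerXn2r ?nnegrE ?ler0n // (ler_nat R 10).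
  apply: le_trans h _; rewrite ler_peMl ?exprn_ge0 ?ler0n //.
  by rewrite -natrM ler1n.
have gap10 e : (2 ^ #|tau| * d + e = n)%N -> (6 * e ^ 2 <= n)%N.
  move=> en; have := bound 10 e (ler0n _ 10) b10 en.
  rewrite -(ler_nat R) natrM natrX; lra.
have d0 : (0 < d)%N.
  rewrite lt0n; apply/eqP => d0; have := gap10 n; rewrite d0 muln0 add0n; nia.
apply: no_majority => //; rewrite card_types; last by move=> e en _; apply: gap10.
move=> en; have [k tauE] : exists k, #|tau| = k.+1 by case: #|tau| tau0 => // k; exists k.
split; first by rewrite -en tauE expnS -mulnA addn1 /= mul2n odd_double.
have n6 := gap10 1%N en.
move: en bound n6; rewrite /t tauE; case: (k) => [|[|j]] en bound n6.
- have := bound 16 1%N (ler0n _ 16) _ en; rewrite -[(2 ^ 1)%N]/2%N expr1n => n10.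
  by apply: ltnW; rewrite -(ltr_nat R); have := n10 ltac:(lra); lra.
- by move: en; rewrite -[(2 ^ 2)%N]/4%N; lia.
have : (0 < 2 ^ j)%N by rewrite expn_gt0.
by move: en; rewrite !expnS; nia.
Qed.

End Main.

Theorem theorem5p10 (R : realType) (tau : finType) (tau_nonempty : (0 < #|tau|)%N)
    (n : nat) (n_gt0 : (0 < n)%N) (d : nat) :
  let t : R := (2 ^ #|tau|)%N%:R in
  c2 t < c1 t /\
  (d%:R <= n%:R / t - c1 t * Num.sqrt n%:R -> has_majority_class tau n d) /\
  (d%:R >= n%:R / t - c2 t * Num.sqrt n%:R -> ~ has_majority_class tau n d).
Proof.
move=> t; split; first exact: c2_lt_c1 (types_ge2 R tau_nonempty).
split; first exact: majority_small_depth.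
exact: no_majority_large_depth.
Qed.
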